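(* Let $0<q<1$, $\alpha>0$, $a\in\mathbb{R}$, let $r,p\ge0$ be integers, and let $$f(x)={}_{r}\phi_{p}\left[\left.\begin{array}{c}a_1,a_2,\dots,a_r\\ b_1,b_2,\dots,b_p\end{array}\right|q,ax\right],$$ where no $b_j$ is of the form $q^{-i}$ with $i\ge 0$ an integer. Let $u,v>0$ be such that the power series defining $f$ converges at $x=u/v$. Then $$N_q\left(x^{\alpha-1}f(x)\right)(u;v)=\frac{\Gamma_q(\alpha)(1-q)^{\alpha-1}u^{\alpha-1}}{v^{\alpha}}\;{}_{r+1}\phi_{p}\left[\left.\begin{array}{c}a_1,a_2,\dots,a_r,q^{\alpha}\\ b_1,b_2,\dots,b_p\end{array}\right|q,a\frac{u}{v}\right].$$
   Context: For $0<q<1$: $(a;q)_n=\prod_{k=0}^{n-1}(1-aq^k)$, $(a;q)_\infty=\prod_{k\ge0}(1-aq^k)$, $(a_1,\dots,a_p;q)_n=\prod_{j=1}^p(a_j;q)_n$, and $E_q(t)=(t;q)_\infty$. The $q$-gamma function is $\Gamma_q(x)=\frac{(q;q)_\infty}{(q^x;q)_\infty}(1-q)^{1-x}$. The Jackson integral is $\int_0^a f(x)\,d_qx=(1-q)a\sum_{k\ge0}f(aq^k)q^k$. The $q$-Natural transform of the first type is $$N_q(f)(u;v)=\frac{1}{(1-q)u}\int_0^{u/v}f(t)\,E_q\!\left(q\tfrac{v}{u}t\right)d_qt=\frac{(q;q)_\infty}{v}\sum_{k\ge0}\frac{q^kf\left(\frac uv q^k\right)}{(q;q)_k},$$ and $N_q(g(x))(u;v)$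 denotes the transform of the function $x\mapsto g(x)$. The function ${}_r\phi_s$ (lower-case; note there is no extra power of $(-1)^nq^{\binom n2}$, for any $r,s$) is $${}_{r}\phi_{s}\left[\left.\begin{array}{c}a_1,\dots,a_r\\ b_1,\dots,b_s\end{array}\right|q,z\right]=\sum_{n\ge0}\frac{(a_1,\dots,a_r;q)_n}{(b_1,\dots,b_s;q)_n}\frac{z^n}{(q;q)_n}.$$ *)

(* Defs.v *)
From HB Require Import structures.
From mathcomp Require Import all_boot all_order all_algebra.
From mathcomp Require Import complex.
From mathcomp Require Import all_classical all_reals all_analysis.

Set Implicit Arguments.
Unset Strict Implicit.
Unset Printing Implicit Defensive.

Import Order.TTheory GRing.Theory Num.Theory.
Import numFieldNormedType.Exports.

Local Open Scope classical_set_scope.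
Local Open Scope ring_scope.
Local Open Scope complex_scope.

(* [qsummable] and [qsum] are stated over an arbitrary numFieldType K, with the
   topology given by its norm, so that they apply both to a realType R and to
   R[i], which only inherits a topology through its numFieldType structure.
   When the series diverges the value of [qsum] is meaningless. *)
Definition qsummable (K : numFieldType) (c : nat -> K) : Prop :=
  cvgn (series c).

Definition qsum (K : numFieldType) (c : nat -> K) : K := limn (series c).

Definition qpoch (K : pzRingType) (a q : K) (n : nat) : K :=
  \prod_(k < n) (1 - a * q ^+ k).

Definition qpochs (K : comPzRingType) (s : seq K) (q : K) (n : nat) : K :=
  \prod_(a <- s) qpoch a q n.

Definition qpoch_inf (K : numFieldType) (a q : K) : K := limn (qpoch a q).

Definition qexpE (K : numFieldType) (q t : K) : K := qpoch_inf t q.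

Definition qGamma (R : realType) (q x : R) : R :=
  qpoch_inf q q / qpoch_inf (q `^ x) q * (1 - q) `^ (1 - x).

(* No factor ((-1) ^ n q ^ C(n,2)) ^ (1 + s - r): this is not the
   Gasper-Rahman normalization unless r = s + 1. *)
Definition qphi_term (K : fieldType) (A B : seq K) (q z : K) (n : nat) : K :=
  qpochs A q n / qpochs B q n * (z ^+ n / qpoch q q n).

Definition qphi (K : numFieldType) (A B : seq K) (q z : K) : K :=
  qsum (qphi_term A B q z).

Definition jackson_term (R : realType) (q : R) (f : R -> R[i]) (a : R)
    (k : nat) : R[i] :=
  f (a * q ^+ k) * (q ^+ k)%:C.

Definition jackson (R : realType) (q : R) (f : R -> R[i]) (a : R) : R[i] :=
  ((1 - q) * a)%:C * qsum (jackson_term q f a).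

Definition qNatural_integrand (R : realType) (q : R) (f : R -> R[i]) (u v : R)
    (t : R) : R[i] :=
  f t * (qexpE q (q * (v / u) * t))%:C.

Definition qNatural (R : realType) (q : R) (f : R -> R[i]) (u v : R) : R[i] :=
  ((1 - q) * u)^-1%:C * jackson q (qNatural_integrand q f u v) (u / v).

Definition qNatural_summable (R : realType) (q : R) (f : R -> R[i]) (u v : R)
    : Prop :=
  qsummable (jackson_term q (qNatural_integrand q f u v) (u / v)).

(* Main.v *)
(* Put G z = [qexp q z] = sum_k z^k / (q;q)_k for 0 <= z < 1. Then (1 - z) G z = G (q z),
   hence (z;q)_n G z = G (z q^n), which tends to 1, and G z = 1 / (z;q)_oo.
   Writing the coefficients of f(x) at x = u/v as t_n and z = q^alpha, the
   transform is, up to a constant, sum_k z^k / (q;q)_k * sum_n t_n q^(kn).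
   Exchanging the sums, the inner sum over k is G (z q^n) = (z;q)_n G z. The
   exchange needs only convergence of sum_n t_n, because the partial sums of
   sum_n t_n q^(kn) converge uniformly in k. *)

Require Import Defs.
From HB Require Import structures.
From mathcomp Require Import all_boot all_order all_algebra.
From mathcomp Require Import complex.
From mathcomp Require Import all_classical all_reals all_analysis.
From mathcomp Require Import ring.

Set Implicit Arguments.
Unset Strict Implicit.
Unset Printing Implicit Defensive.

Import Order.TTheory GRing.Theory Num.Theory.
Import numFieldNormedType.Exports.

Local Open Scope classical_set_scope.
Local Open Scope ring_scope.
Local Open Scope complex_scope.

(** * Finite q-shifted factorials *)

Lemma qpochSr (K : comPzRingType) (a q : K) (n : nat) :
  qpoch a q n.+1 = qpoch a q n * (1 - a * q ^+ n).
Proof. by rewrite /qpoch big_ord_recr. Qed.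

Lemma qpoch_gt0 (R : realType) (z q : R) (n : nat) :
  0 <= z < 1 -> 0 < q < 1 -> 0 < qpoch z q n.
Proof.
move=> /andP[z0 z1] /andP[q0 q1]; apply: prodr_gt0 => i _.
rewrite subr_gt0 (le_lt_trans _ z1)// ler_piMr// exprn_ile1// ?ltW//.
Qed.

(** * The q-exponential series and its product form *)

Definition qexp_term (R : realType) (q z : R) (k : nat) : R :=
  z ^+ k / qpoch q q k.

Definition qexp (R : realType) (q z : R) : R := limn (series (qexp_term q z)).

Section qexp_theory.
Variables (R : realType) (q : R).
Hypothesis (q01 : 0 < q < 1).

Let q_gt0 : 0 < q. Proof. by case/andP: q01. Qed.
Let q_lt1 : q < 1. Proof. by case/andP: q01. Qed.
Let q_ge0 : 0 <= q. Proof. exact: ltW. Qed.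

Let poch_gt0 n : 0 < qpoch q q n.
Proof. by apply: qpoch_gt0 => //; rewrite q_ge0 q_lt1. Qed.

Lemma qexp_term_ge0 z k : 0 <= z -> 0 <= qexp_term q z k.
Proof. by move=> z0; rewrite divr_ge0 ?exprn_ge0// ltW. Qed.

Lemma qexp_termM z y k : qexp_term q (z * y) k = qexp_term q z k * y ^+ k.
Proof. by rewrite /qexp_term exprMn mulrAC. Qed.

(** Comparing coefficients, [1 / (q;q)_k - 1 / (q;q)_(k-1) = q^k / (q;q)_k]; truncation leaves one
    boundary term. This exact finite form of [(1 - z) G z = G (q z)] serves both to prove
    convergence and to pass to the limit. *)
Lemma qexp_partial_shift z n :
  (1 - z) * series (qexp_term q z) n.+1 =
  series (qexp_term q (z * q)) n.+1 - z * qexp_term q z n.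
Proof.
rewrite /series /=; elim: n => [|n IH].
  by rewrite !big_nat1 /qexp_term /qpoch !big_ord0 !expr0; field.
rewrite big_nat_recr//= [in RHS]big_nat_recr//= mulrDr IH.
rewrite /qexp_term qpochSr exprMn -exprS.
have h1 : qpoch q q n != 0 by rewrite gt_eqF.
have h2 : 1 - q * q ^+ n != 0.
  by rewrite -exprS gt_eqF// subr_gt0 exprn_ilt1// ltW.
by rewrite !exprS; field; rewrite h1 h2.
Qed.

Let shift01 z n : 0 <= z < 1 -> 0 <= z * q ^+ n < 1.
Proof.
move=> /andP[z0 z1]; rewrite mulr_ge0 ?exprn_ge0//=.
by rewrite (le_lt_trans _ z1)// ler_piMr// exprn_ile1// ltW.
Qed.

(** Iterates [qexp_partial_shift] [m] times, dropping the nonnegative boundary term each time. *)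
Let partial_le z m n : 0 <= z < 1 ->
  qpoch z q m * series (qexp_term q z) n.+1 <=
  series (qexp_term q (z * q ^+ m)) n.+1.
Proof.
move=> z01; elim: m => [|m IH]; first by rewrite /qpoch big_ord0 mul1r expr0 mulr1.
have zm := shift01 m z01.
rewrite qpochSr mulrAC mulrC (le_trans (ler_wpM2l _ IH))//.
  by rewrite subr_ge0 ltW//; case/andP: zm.
rewrite qexp_partial_shift -mulrA -exprSr gerBl mulr_ge0//.
  by case/andP: zm.
by apply: qexp_term_ge0; case/andP: zm.
Qed.

(* By [partial_le] it suffices to bound the partial sums at [z * q ^+ m], which
   is at most [(1 - q) / 2] for large [m]; as [(q;q)_i >= (1 - q)^i], the terms
   are then at most [2 ^- i]. *)
Lemma is_cvg_qexp z : 0 <= z < 1 -> cvgn (series (qexp_term q z)).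
Proof.
move=> z01; have [z0 z1] := andP z01.
have q1_gt0 : 0 < (1 - q) / 2 by rewrite divr_gt0// subr_gt0.
have [m zm] : exists m, z * q ^+ m <= (1 - q) / 2.
  have /cvgrPdist_le/(_ _ q1_gt0)[m _ /(_ m (leqnn m))] :
      z * q ^+ n @[n --> \oo] --> 0.
    rewrite -[X in _ --> X](mulr0 z); apply: cvgMl_tmp.
    by apply: cvg_expr; rewrite gtr0_norm.
  rewrite /= sub0r normrN => zm; exists m.
  exact: le_trans (ler_norm _) zm.
have z_m := shift01 m z01.
have mono : nondecreasing_seq (series (qexp_term q z)).
  by apply: nondecreasing_series => n _ _; exact: qexp_term_ge0.
apply: nondecreasing_is_cvgn => //.
exists (2 / qpoch z q m) => _ [n _ <-].
rewrite (le_trans (mono _ _ (leqnSn n)))//.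
rewrite ler_pdivlMr ?qpoch_gt0// mulrC (le_trans (partial_le _ _ z01))//.
apply: (@le_trans _ _ (series (geometric 1 2^-1) n.+1)).
  apply: ler_sum => i _; rewrite /= mul1r /qexp_term ler_pdivrMr//.
  have : ((1 - q) / 2) ^+ i <= 2^-1 ^+ i * qpoch q q i.
    rewrite exprMn mulrC ler_wpM2l ?exprn_ge0// /qpoch.
    rewrite -[X in _ ^+ X <= _]card_ord -prodr_const.
    apply: ler_prod => j _; rewrite subr_ge0 ltW//= lerB//.
    by rewrite ler_piMr// exprn_ile1// ltW.
  by apply: le_trans; rewrite lerXn2r ?nnegrE ?(ltW q1_gt0)//; case/andP: z_m.
have half_lt1 : `|2^-1 : R| < 1 by rewrite ger0_norm// invf_lt1// ltr1n.
apply: le_trans (geometric_le_lim _ ler01 _ half_lt1) _ => //.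
by have -> : 1 / (1 - 2^-1) = 2 :> R by field.
Qed.

(** Limit of [qexp_partial_shift]: the boundary term vanishes, being [z] times the general term of a
    convergent series. *)
Lemma qexp_shift z : 0 <= z < 1 -> (1 - z) * qexp q z = qexp q (z * q).
Proof.
move=> z01; have cz := is_cvg_qexp z01.
have czq : cvgn (series (qexp_term q (z * q))).
  by have := is_cvg_qexp (shift01 1 z01); rewrite expr1.
suff : (1 - z) * series (qexp_term q z) n.+1 @[n --> \oo] --> qexp q (z * q).
  move=> /cvg_lim <-//; apply/esym/cvg_lim => //; apply: cvgMl_tmp.
  by rewrite (cvg_shiftS (series (qexp_term q z))).
under eq_cvg do rewrite qexp_partial_shift.
have -> : qexp q (z * q) = qexp q (z * q) - z * 0 by rewrite mulr0 subr0.
apply: cvgB.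
  by rewrite (cvg_shiftS (series (qexp_term q (z * q)))).
by apply: cvgMl_tmp; exact: cvg_series_cvg_0.
Qed.

Lemma qexp_qpoch z n : 0 <= z < 1 ->
  qpoch z q n * qexp q z = qexp q (z * q ^+ n).
Proof.
move=> z01; elim: n => [|n IH]; first by rewrite /qpoch big_ord0 mul1r expr0 mulr1.
by rewrite qpochSr mulrAC IH mulrC qexp_shift ?shift01// -mulrA -exprSr.
Qed.

Lemma qexp_ge1 z : 0 <= z < 1 -> 1 <= qexp q z.
Proof.
move=> z01; have [z0 _] := andP z01.
have := @nondecreasing_cvgn_le _ _ _ (is_cvg_qexp z01) 1%N.
rewrite /series/= big_nat1 /qexp_term/= /qpoch big_ord0 divr1; apply.
by apply: nondecreasing_series => k _ _; exact: qexp_term_ge0.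
Qed.

(** The constant terms cancel the [1]s, and every later term carries a factor [(q ^+ n) ^+ i.+1], at
    most [q ^+ n]. This gives [G (z q^n) -> 1] with an explicit rate, without continuity of [G]. *)
Lemma qexp_near0 z n : 0 <= z < 1 ->
  qexp q (z * q ^+ n) - 1 <= q ^+ n * (qexp q z - 1).
Proof.
move=> z01; have [z0 _] := andP z01.
have c1 := is_cvg_qexp (shift01 n z01).
apply: (@ler_cvg_to _ \oo _ _ (fun k => series (qexp_term q (z * q ^+ n)) k.+1 - 1)
  (fun k => q ^+ n * (series (qexp_term q z) k.+1 - 1))).
- apply: cvgB; last exact: cvg_cst.
  by rewrite (cvg_shiftS (series (qexp_term q (z * q ^+ n)))).
- apply: cvgMl_tmp; apply: cvgB; last exact: cvg_cst.
  by rewrite (cvg_shiftS (series (qexp_term q z))); exact: is_cvg_qexp.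
- near=> k; rewrite /series/= !big_nat_recl//= /qexp_term !expr0 /qpoch big_ord0 divr1.
  rewrite ![1 + _]addrC !addrK mulr_sumr; apply: ler_sum => i _.
  rewrite exprMn mulrAC mulrC ler_wpM2r//; first exact: (@qexp_term_ge0 z i.+1).
  by rewrite exprS ler_piMr ?exprn_ge0// exprn_ile1 ?exprn_ge0// exprn_ile1// ltW.
Unshelve. all: by end_near.
Qed.

Lemma qpoch_infE z : 0 <= z < 1 -> qpoch_inf z q = (qexp q z)^-1.
Proof.
move=> z01; have G0 : qexp q z != 0.
  by rewrite gt_eqF// (lt_le_trans ltr01)// qexp_ge1.
apply: cvg_lim => //.
have -> : qpoch z q = fun n => qexp q (z * q ^+ n) * (qexp q z)^-1.
  by apply/funext => n; rewrite -qexp_qpoch// mulfK.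
rewrite -[X in _ --> X]mul1r; apply: cvgMr_tmp.
apply: (@squeeze_cvgr _ _ _ _ (cst 1) (fun n => q ^+ n * (qexp q z - 1) + 1)).
- near=> n; rewrite qexp_ge1 ?shift01//= -lerBlDr.
  exact: qexp_near0.
- exact: cvg_cst.
- rewrite -[X in _ --> X]add0r -[X in _ --> X + _](mul0r (qexp q z - 1)).
  apply: cvgD; last exact: cvg_cst.
  by apply: cvgMr_tmp; apply: cvg_expr; rewrite gtr0_norm.
Unshelve. all: by end_near.
Qed.

End qexp_theory.

(** * Exchange of the two summations over the reals *)

Section exchange.
Variables (R : realType) (q : R).
Hypothesis (q01 : 0 < q < 1).

Let q_gt0 : 0 < q. Proof. by case/andP: q01. Qed.
Let q_lt1 : q < 1. Proof. by case/andP: q01. Qed.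

Lemma is_cvg_power_series (t : R^nat) k : cvgn (series t) ->
  cvgn (series (fun n => t n * (q ^+ k) ^+ n)).
Proof.
case: k => [|k] ct.
  by under eq_fun do rewrite expr0 expr1n mulr1.
apply: normed_cvg => /=.
have [M M0 tM] : exists2 M, 0 < M & forall n, `|t n| <= M.
  have [M [_ /(_ (`|M| + 1))tM]] := cvg_series_bounded ct.
  (* [M] need not be positive, and only numbers above it are known to bound the terms; [|M| + 1] is
     positive and exceeds [M]. *)
  exists (`|M| + 1) => [|n]; first by rewrite ltr_wpDl.
  by apply: tM => //; rewrite (le_lt_trans (ler_norm M))// ltrDl.
apply: (@series_le_cvg _ _ (geometric M q)) => [n|n|n|].
- exact: normr_ge0.
- by rewrite /= mulr_ge0 ?exprn_ge0 ?ltW.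
- rewrite /= normrM ler_pM// -exprM normrX (gtr0_norm q_gt0).
  by rewrite mulSn exprD ler_piMr ?exprn_ge0 ?exprn_ile1 ?ltW.
- by apply: is_cvg_geometric_series; rewrite gtr0_norm.
Qed.

(* Only convergence of [series t] is available at [k = 0]; for [k > 0] the tail
   is dominated by a geometric series of ratio [q], independently of [k]. *)
Lemma power_series_unif (t F : R^nat) (e : R) :
  (forall k, series (fun n => t n * (q ^+ k) ^+ n) @ \oo --> F k) -> 0 < e ->
  \forall N \near \oo, forall k,
    `|F k - series (fun n => t n * (q ^+ k) ^+ n) N| <= e.
Proof.
move=> tF e0; have t0F := tF 0%N.
have t_cvg0 : t n @[n --> \oo] --> 0.
  apply: cvg_series_cvg_0; apply: (cvgP (F 0%N)).
  by move: t0F; under eq_fun do rewrite expr0 expr1n mulr1.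
(* The factor [1 - q] cancels the bound [1 / (1 - q)] on geometric tails, leaving [e]. *)
have e1 : 0 < e * (1 - q) by rewrite mulr_gt0// subr_gt0.
have [N0 _ tN0] := cvgr0_norm_le _ t_cvg0 _ e1.
near=> N => -[|k].
  near: N; exact: (cvgr_dist_le _ _ t0F _ e0).
set S := series _.
apply: (@cvgr_to_le _ \oo _ _ (fun M => `|S M - S N|)).
  by apply: cvg_norm; apply: cvgB; [exact: tF|exact: cvg_cst].
near=> M.
have NM : (N <= M)%N by near: M; exact: nbhs_infty_ge.
rewrite sub_series_geq// (le_trans (ler_norm_sum _ _ _))//.
apply: (@le_trans _ _ (\sum_(N <= n < N + (M - N)) e * (1 - q) * q ^+ n)).
  rewrite subnKC// [leLHS]big_nat_cond [leRHS]big_nat_cond.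
  apply: ler_sum => n /andP[/andP[Nn _] _].
  rewrite normrM ler_pM//.
    apply: tN0 => /=; rewrite (leq_trans _ Nn)//.
    by near: N; exact: nbhs_infty_ge.
  rewrite -exprM normrX (gtr0_norm q_gt0) mulSn exprD.
  by rewrite ler_piMr ?exprn_ge0 ?exprn_ile1 ?ltW.
rewrite -mulr_sumr geometric_partial_tail -mulrA ger_pMr//.
have q1 : 0 < 1 - q by rewrite subr_gt0.
rewrite mulrC -ler_pdivlMr// div1r.
rewrite (le_trans (geometric_le_lim _ _ _ _)) ?exprn_ge0 ?gtr0_norm ?(ltW q_gt0)//.
by rewrite ler_piMl ?invr_ge0 ?exprn_ile1 ?ltW.
Unshelve. all: by end_near.
Qed.

(** For a sum over [n < N] the exchange is linearity of limits: the index [n] contributes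
    [t n * G (z q^n)], which is [t n * (z;q)_n * G z]. *)
Lemma cvg_qexp_partial (t : R^nat) z N : 0 <= z < 1 ->
  series (fun k => qexp_term q z k * series (fun n => t n * (q ^+ k) ^+ n) N)
    @ \oo --> qexp q z * series (fun n => t n * qpoch z q n) N.
Proof.
move=> z01; have [z0 z1] := andP z01.
elim: N => [|N IH].
  have S0 (c : R^nat) : series c 0 = 0 by rewrite /series/= big_geq.
  rewrite S0 mulr0; set c := fun k => _.
  have -> : series c = cst 0.
    by apply/funext => K; rewrite /series/= big1// => k _; rewrite /c S0 mulr0.
  exact: cvg_cst.
have zN : 0 <= z * q ^+ N < 1.
  rewrite mulr_ge0 ?exprn_ge0 ?(ltW q_gt0)//= (le_lt_trans _ z1)// ler_piMr//.
  by rewrite exprn_ile1 ?ltW.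
have -> : series (fun k => qexp_term q z k *
      series (fun n => t n * (q ^+ k) ^+ n) N.+1) =
    fun K =>
      series (fun k => qexp_term q z k * series (fun n => t n * (q ^+ k) ^+ n) N) K
      + t N * series (qexp_term q (z * q ^+ N)) K.
  apply/funext => K; rewrite /series/= mulr_sumr -big_split/=.
  apply: eq_bigr => k _; rewrite big_nat_recr//= mulrDr; congr (_ + _).
  by rewrite qexp_termM mulrCA -!exprM mulnC.
have -> : qexp q z * series (fun n => t n * qpoch z q n) N.+1 =
    qexp q z * series (fun n => t n * qpoch z q n) N + t N * qexp q (z * q ^+ N).
  by rewrite seriesSr -qexp_qpoch//; ring.
by apply: cvgD => //; apply: cvgMl_tmp; exact: is_cvg_qexp.
Qed.

(** Convergence of the series in [n] is derived together with its value. The series in [k] converges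
    first, by domination; its limit [L] forces the sum in [n] to be [L / G]. *)
Lemma qexp_exchange (t F : R^nat) z : 0 <= z < 1 ->
  (forall k, series (fun n => t n * (q ^+ k) ^+ n) @ \oo --> F k) ->
  exists s, series (fun n => t n * qpoch z q n) @ \oo --> s /\
    series (fun k => qexp_term q z k * F k) @ \oo --> qexp q z * s.
Proof.
move=> z01 tF; have [z0 z1] := andP z01.
have G1 := qexp_ge1 q01 z01; set G := qexp q z in G1 *.
have G0 : 0 < G by exact: lt_le_trans ltr01 G1.
have d0 k : 0 <= qexp_term q z k by exact: qexp_term_ge0.
have dG := is_cvg_qexp q01 z01.
have cF : cvgn (series (fun k => qexp_term q z k * F k)).
  (* Uniformity with tolerance [1] bounds all [F k] at once by a constant [C]. *)
  have [N _ /(_ N (leqnn N)) FN] := power_series_unif tF ltr01.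
  set C := 1 + \sum_(0 <= n < N) `|t n|.
  have FC k : `|F k| <= C.
    rewrite -(subrK (series (fun n => t n * (q ^+ k) ^+ n) N) (F k)).
    rewrite (le_trans (ler_normD _ _))// lerD// (le_trans (ler_norm_sum _ _ _))//.
    apply: ler_sum => n _; rewrite normrM ler_piMr// !normrX (gtr0_norm q_gt0).
    by rewrite !exprn_ile1 ?exprn_ge0 ?ltW.
  apply: normed_cvg => /=.
  apply: (@series_le_cvg _ _ (fun k => C *: qexp_term q z k)) => [k|k|k|].
  - exact: normr_ge0.
  - by rewrite /= mulr_ge0// (le_trans _ (FC 0%N)).
  - by rewrite /= normrM (ger0_norm (d0 k)) [leRHS]mulrC ler_wpM2l.
  - exact: is_cvg_seriesZ.
set L := limn _ in cF.
exists (L / G); split; last by rewrite mulrCA divff ?gt_eqF// mulr1.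
apply/cvgrPdist_le => e e0.
near=> N.
(* After multiplication by [G], the error is the limit in [K] of the partial sums of
   [qexp_term q z k * (F k - P k)]. Each factor [F k - P k] is at most [e] in norm and the weights
   sum to [G]. *)
rewrite -(ler_pM2l G0) -{1}(gtr0_norm G0) -normrM mulrBr mulrCA divff ?gt_eqF//.
rewrite mulr1.
set P := fun k => series (fun n => t n * (q ^+ k) ^+ n) N.
apply: (@cvgr_to_le _ \oo _ _ (fun K => `|series (fun k => qexp_term q z k * F k) K
   - series (fun k => qexp_term q z k * P k) K|)).
  by apply: cvg_norm; apply: cvgB => //; exact: cvg_qexp_partial.
near=> K.
rewrite /series/= -sumrB (le_trans (ler_norm_sum _ _ _))//.
apply: (@le_trans _ _ (\sum_(0 <= k < K) qexp_term q z k * e)).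
  apply: ler_sum => k _; rewrite -mulrBr normrM (ger0_norm (d0 k)) ler_wpM2l//.
  rewrite /P; move: k; near: N; exact: power_series_unif.
rewrite -mulr_suml ler_pM2r//.
apply: nondecreasing_cvgn_le => //.
by apply: nondecreasing_series => k _ _.
Unshelve. all: by end_near.
Qed.

End exchange.

(** * Convergence and value of a series as a single relation *)

Definition has_qsum (K : numFieldType) (c : nat -> K) (s : K) : Prop :=
  series c @ \oo --> s.

Lemma has_qsumE (K : numFieldType) (c : nat -> K) (s : K) :
  has_qsum c s -> qsum c = s.
Proof. by move=> cs; apply: cvg_lim => //; exact: norm_hausdorff. Qed.

Lemma has_qsum_summable (K : numFieldType) (c : nat -> K) (s : K) :
  has_qsum c s -> qsummable c.
Proof. by move=> cs; apply: cvgP cs. Qed.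

Lemma qsummable_has_qsum (K : numFieldType) (c : nat -> K) :
  qsummable c -> has_qsum c (qsum c).
Proof. by []. Qed.

Lemma has_qsumZ (K : numFieldType) (c : nat -> K) (s w : K) :
  has_qsum c s -> has_qsum (fun n => w * c n) (w * s).
Proof.
move=> cs; rewrite /has_qsum.
have -> : series (fun n => w * c n) = fun n => w * series c n.
  by apply/funext => n; rewrite /series/= mulr_sumr.
exact: cvgMl_tmp.
Qed.

(** * Complex series, handled through real and imaginary parts *)

Section complex_series.
Variable R : realType.
Implicit Types (c : nat -> R[i]) (x s : R[i]).

Lemma complex_norm_ge_Im x : `|complex.Im x|%:C <= `|x|.
Proof.
rewrite normc_def lecR -sqrtr_sqr ler_sqrt ?addr_ge0 ?sqr_ge0//.
by rewrite lerDr sqr_ge0.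
Qed.

Lemma complex_norm_le x : `|x| <= (`|complex.Re x| + `|complex.Im x|)%:C.
Proof.
rewrite normc_def lecR -[leRHS]ger0_norm ?addr_ge0// -sqrtr_sqr.
rewrite ler_sqrt ?sqr_ge0// sqrrD !real_normK ?num_real//.
by rewrite addrAC lerDl mulrn_wge0// mulr_ge0.
Qed.

Lemma Re_series c n : complex.Re (series c n) = series (fun k => complex.Re (c k)) n.
Proof.
elim: n => [|n IH]; first by rewrite /series/= !big_geq.
by rewrite !seriesSr -IH; case: (series c n) (c n) => ? ? [].
Qed.

Lemma Im_series c n : complex.Im (series c n) = series (fun k => complex.Im (c k)) n.
Proof.
elim: n => [|n IH]; first by rewrite /series/= !big_geq.
by rewrite !seriesSr -IH; case: (series c n) (c n) => ? ? [].
Qed.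

Lemma has_qsum_complexP c s :
  has_qsum c s <-> has_qsum (fun k => complex.Re (c k)) (complex.Re s) /\
                   has_qsum (fun k => complex.Im (c k)) (complex.Im s).
Proof.
have ReB x y : complex.Re (x - y) = complex.Re x - complex.Re y :> R.
  by case: x y => ? ? [].
have ImB x y : complex.Im (x - y) = complex.Im x - complex.Im y :> R.
  by case: x y => ? ? [].
split=> [/cvgrPdist_le cs|[/cvgrPdist_le cRe /cvgrPdist_le cIm]].
- split; apply/cvgrPdist_le => e e0; have /cs : 0 < e%:C by rewrite ltcR.
    apply: filterS => n h; rewrite -Re_series -ReB -lecR.
    exact: le_trans (normc_ge_Re _) h.
  apply: filterS => n h; rewrite -Im_series -ImB -lecR.
  exact: le_trans (complex_norm_ge_Im _) h.
- apply/cvgrPdist_le => e e0.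
  (* Here [e] lives in [R[i]], where positivity forces it to be real. *)
  have eE : e = (complex.Re e)%:C by rewrite RRe_real// gtr0_real.
  rewrite eE ltcR in e0 *; have e2 : 0 < complex.Re e / 2 by rewrite divr_gt0.
  near=> n.
  rewrite (le_trans (complex_norm_le _))// lecR ReB ImB Re_series Im_series.
  rewrite [leRHS]splitr lerD//; near: n; [exact: cRe|exact: cIm].
Unshelve. all: by end_near.
Qed.

Lemma qsummable_complexP c :
  qsummable c <-> qsummable (fun k => complex.Re (c k)) /\
                  qsummable (fun k => complex.Im (c k)).
Proof.
split=> [/qsummable_has_qsum/has_qsum_complexP[r i]|[r i]].
  by split; [exact: has_qsum_summable r|exact: has_qsum_summable i].
apply: (@has_qsum_summable _ _ (limn (series (fun k => complex.Re (c k))) +i*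
  limn (series (fun k => complex.Im (c k))))).
by apply/has_qsum_complexP.
Qed.

Lemma ReMreal x (r : R) : complex.Re (x * r%:C) = complex.Re x * r.
Proof. by case: x => a b /=; rewrite mulr0 subr0. Qed.

Lemma ImMreal x (r : R) : complex.Im (x * r%:C) = complex.Im x * r.
Proof. by case: x => a b /=; rewrite mulr0 add0r. Qed.

(** All the weights are real, so the real exchange applies separately to the real and imaginary
    parts of [t]. *)
Lemma qexp_exchange_complex (q z : R) (t : nat -> R[i]) :
  0 < q < 1 -> 0 <= z < 1 -> qsummable t ->
  exists s, has_qsum (fun n => t n * (qpoch z q n)%:C) s /\
    has_qsum (fun k => qsum (fun n => t n * ((q ^+ k) ^+ n)%:C) *
                       (qexp_term q z k)%:C) (s * (qexp q z)%:C).
Proof.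
move=> q01 z01 /qsummable_complexP[tr ti].
set F := fun k => qsum (fun n => t n * ((q ^+ k) ^+ n)%:C).
have tF k : has_qsum (fun n => t n * ((q ^+ k) ^+ n)%:C) (F k).
  apply/qsummable_has_qsum/qsummable_complexP; split.
    under eq_fun do rewrite ReMreal; exact: is_cvg_power_series.
  under eq_fun do rewrite ImMreal; exact: is_cvg_power_series.
have [sr [sr1 sr2]] : exists s : R,
    has_qsum (fun n => complex.Re (t n) * qpoch z q n) s /\
    has_qsum (fun k => qexp_term q z k * complex.Re (F k)) (qexp q z * s).
  apply: qexp_exchange => // k; have /has_qsum_complexP[+ _] := tF k.
  by under eq_fun do rewrite ReMreal.
have [si [si1 si2]] : exists s : R,
    has_qsum (fun n => complex.Im (t n) * qpoch z q n) s /\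
    has_qsum (fun k => qexp_term q z k * complex.Im (F k)) (qexp q z * s).
  apply: qexp_exchange => // k; have /has_qsum_complexP[_ +] := tF k.
  by under eq_fun do rewrite ImMreal.
exists (sr +i* si); split; apply/has_qsum_complexP.
- by split; [under eq_fun do rewrite ReMreal|under eq_fun do rewrite ImMreal].
- rewrite ReMreal ImMreal/= ![_ * qexp q z]mulrC; split.
    by under eq_fun do rewrite ReMreal mulrC.
  by under eq_fun do rewrite ImMreal mulrC.
Qed.

End complex_series.

(** * Hypergeometric terms, the Jackson nodes and the transform *)

Lemma qpoch_real (R : realType) (x q : R) n :
  qpoch x%:C q%:C n = (qpoch x q n)%:C.
Proof.
rewrite /qpoch rmorph_prod; apply: eq_bigr => i _.
by rewrite rmorphB rmorph1 rmorphM rmorphXn.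
Qed.

(** With [b] equal to [q^alpha], the extra factor is exactly the weight [(z;q)_n] produced by the
    exchange. *)
Lemma qphi_term_rcons (K : fieldType) (A B : seq K) (b q z : K) n :
  qphi_term (rcons A b) B q z n = qphi_term A B q z n * qpoch b q n.
Proof. by rewrite /qphi_term /qpochs -cats1 big_cat big_seq1/=; ring. Qed.

Lemma qphi_termM (K : fieldType) (A B : seq K) (q z y : K) n :
  qphi_term A B q (z * y) n = qphi_term A B q z n * y ^+ n.
Proof. by rewrite /qphi_term exprMn; ring. Qed.

(** Turns the kernel [E_q] at the [k]-th Jackson node into the coefficient [1 / (q;q)_k] of the
    q-exponential. *)
Lemma qpoch_inf_shift (R : realType) (q : R) k : 0 < q < 1 ->
  qpoch_inf (q * q ^+ k) q = qpoch_inf q q / qpoch q q k.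
Proof.
move=> /[dup] q01 /andP[q0 q1].
have qq : 0 <= q < 1 by rewrite ltW.
have qk : 0 <= q * q ^+ k < 1.
  by rewrite mulr_ge0 ?exprn_ge0 ?ltW//= -exprS exprn_ilt1 ?ltW.
by rewrite !qpoch_infE// -qexp_qpoch// invfM mulrC.
Qed.

(** For [x = q], the Jackson weight [q^k] and the power [(q^k)^(alpha - 1)] combine into [z^k] with
    [z = q^alpha]. *)
Lemma mulr_powRB1_exprn (R : realType) (x y : R) n : 0 <= x -> 0 < y ->
  x ^+ n * (x ^+ n) `^ (y - 1) = (x `^ y) ^+ n.
Proof.
move=> x0 y0; rewrite mulr_powRB1 ?exprn_ge0//.
by rewrite -(powR_mulrn n x0) -(powR_mulrn n (powR_ge0 x y)) -!powRrM mulrC.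
Qed.

(** Since [qsum] is meaningless for a divergent series, summability on both sides is part of the
    conclusion. *)
Theorem theorem3 (R : realType) (q alpha a : R) (r p : nat)
    (A : r.-tuple R[i]) (B : p.-tuple R[i]) (u v : R)
    (q_gt0 : 0 < q) (q_lt1 : q < 1) (alpha_gt0 : 0 < alpha)
    (B_ok : forall (b : R[i]) (i : nat), b \in B -> b <> (q ^- i)%:C)
    (u_gt0 : 0 < u) (v_gt0 : 0 < v)
    (f_cvg : qsummable (qphi_term A B q%:C (a * (u / v))%:C)) :
  let f := fun x : R => qphi A B q%:C (a * x)%:C in
  let g := fun x : R => (x `^ (alpha - 1))%:C * f x in
  let A' := [tuple of rcons A (q `^ alpha)%:C] in
  [/\ qNatural_summable q g u v,
      qsummable (qphi_term A' B q%:C (a * (u / v))%:C)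
    & qNatural q g u v =
      (qGamma q alpha * (1 - q) `^ (alpha - 1) * u `^ (alpha - 1)
        / v `^ alpha)%:C * qphi A' B q%:C (a * (u / v))%:C].
Proof.
move=> f g A'.
have q01 : 0 < q < 1 by rewrite q_gt0.
have uv_gt0 : 0 < u / v by rewrite divr_gt0.
set z := q `^ alpha.
have z01 : 0 <= z < 1.
  rewrite powR_ge0/=; have <- : 1 `^ alpha = 1 :> R by rewrite powR1.
  by apply: gt0_ltr_powR; rewrite ?nnegrE ?ltW.
have [s [s1 s2]] := qexp_exchange_complex q01 z01 f_cvg.
set X := (u / v) `^ (alpha - 1).
have term_phi : qphi_term A' B q%:C (a * (u / v))%:C =
    fun n => qphi_term A B q%:C (a * (u / v))%:C n * (qpoch z q n)%:C.
  by apply/funext => n; rewrite qphi_term_rcons qpoch_real.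
have term_jackson : jackson_term q (qNatural_integrand q g u v) (u / v) =
    fun k => (X * qpoch_inf q q)%:C *
      (qsum (fun n => qphi_term A B q%:C (a * (u / v))%:C n * ((q ^+ k) ^+ n)%:C)
       * (qexp_term q z k)%:C).
  apply/funext => k; rewrite /jackson_term /qNatural_integrand /qexpE /g /f.
  have -> : q * (v / u) * (u / v * q ^+ k) = q * q ^+ k.
    by field; rewrite !gt_eqF.
  have -> : qphi A B q%:C (a * (u / v * q ^+ k))%:C =
      qsum (fun n => qphi_term A B q%:C (a * (u / v))%:C n * ((q ^+ k) ^+ n)%:C).
    rewrite /qphi; congr (qsum _); apply/funext => n.
    by rewrite mulrA rmorphM qphi_termM -rmorphXn.
  rewrite qpoch_inf_shift// powRM ?exprn_ge0 ?ltW//.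
  rewrite /qexp_term -(mulr_powRB1_exprn _ (ltW q_gt0))//; move: (qsum _) => S.
  by rewrite !rmorphM/=; ring.
have J := has_qsumZ (w := (X * qpoch_inf q q)%:C) s2.
rewrite -term_jackson in J.
split.
- exact: has_qsum_summable J.
- by rewrite term_phi; exact: has_qsum_summable s1.
rewrite /qNatural /jackson (has_qsumE J) /qphi term_phi (has_qsumE s1).
(* As [G z = 1 / (q^alpha;q)_oo], the product [(q;q)_oo * G z] is
   [Gamma_q(alpha) (1 - q)^(alpha - 1)]; the remaining factors are powers of [u] and [v]. *)
have <- : ((1 - q) * u)^-1 * ((1 - q) * (u / v)) * (X * qpoch_inf q q) * qexp q z =
    qGamma q alpha * (1 - q) `^ (alpha - 1) * u `^ (alpha - 1) / v `^ alpha.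
  have q1 : 0 < 1 - q by rewrite subr_gt0.
  have -> : u `^ (alpha - 1) = X * v `^ (alpha - 1).
    by rewrite -powRM ?ltW// divfK ?gt_eqF.
  have -> : v `^ alpha = v `^ (alpha - 1) * v.
    by rewrite mulrC mulr_powRB1 ?ltW.
  have vp : v `^ (alpha - 1) != 0 by rewrite gt_eqF// powR_gt0.
  rewrite /qGamma -(opprB alpha 1) powRN.
  have qp : (1 - q) `^ (alpha - 1) != 0 by rewrite gt_eqF// powR_gt0.
  rewrite -/z (qpoch_infE q01 z01) invrK.
  by field; rewrite vp qp !gt_eqF.
by rewrite !rmorphM/=; ring.
Qed.
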